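(* Let $G$ be the group $V_{8n}=\langle x,y : x^{2n}=y^4=1,\ yx=x^{-1}y^{-1},\ y^{-1}x=x^{-1}y\rangle$, where $n\ge 2$. Then the commuting conjugacy class graph $\Gamma(G)$ is not CN-hyperenergetic.
   Context: For a finite non-abelian group $G$, the commuting conjugacy class graph $\Gamma(G)$ is the simple undirected graph whose vertices are the conjugacy classes of the non-central elements of $G$; two distinct vertices $a^G$ and $b^G$ are adjacent if there exist $a'\in a^G$, $b'\in b^G$ with $a'b'=b'a'$. For a finite simple graph $\mathcal{G}$ with vertices $v_1,\dots,v_N$, the common neighbourhood matrix $CN(\mathcal{G})$ is the $N\times N$ matrix whose $(i,j)$ entry is, for $i\ne j$, the number of vertices other than $v_i,v_j$ adjacent to both $v_i$ and $v_j$, and is $0$ for $i=j$. The CN-energy $E_{CN}(\mathcal{G})$ is the sum of the absolute values of the eigenvalues of $CN(\mathcal{G})$, counted with multiplicity. With $K_N$ the complete graph on $N=|V(\mathcal{G})|$ vertices, $\mathcal{G}$ is CN-hyperenergetic if $E_{CN}(\mathcal{G})>E_{CN}(K_N)$. *)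

(* Defs.v *)
From HB Require Import structures.
From mathcomp Require Import all_boot all_order all_fingroup all_algebra all_solvable all_field.

Set Implicit Arguments.
Unset Strict Implicit.
Unset Printing Implicit Defensive.

Import Order.TTheory GRing.Theory Num.Theory.

Record sgraph := SGraph {
  svertex :> finType;
  sedge : rel svertex;
  sedge_sym : symmetric sedge;
  sedge_irr : irreflexive sedge }.

Arguments sedge {_} _ _.

Lemma neq_rel_sym (T : eqType) : symmetric (fun u v : T => u != v).
Proof. by move=> u v; rewrite eq_sym. Qed.

Lemma neq_rel_irr (T : eqType) : irreflexive (fun u v : T => u != v).
Proof. by move=> u; rewrite eqxx. Qed.

Definition complete_graph (N : nat) : sgraph :=
  SGraph (@neq_rel_sym 'I_N) (@neq_rel_irr 'I_N).

Section CNEnergy.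
Local Open Scope ring_scope.

Definition common_neighbours (g : sgraph) (u v : g) : {set g} :=
  [set w | [&& w != u, w != v, sedge u w & sedge v w]].

(* The vertices are listed by [enum_val].  The entries are taken in [algC],
   which contains all the eigenvalues of an integer matrix. *)
Definition CN_matrix (g : sgraph) : 'M[algC]_#|g| :=
  \matrix_(i, j) if i == j then 0
                 else #|common_neighbours (enum_val i) (enum_val j)|%:R.

(* The roots of the characteristic polynomial, repeated according to their
   multiplicity. *)
Definition eigenvalues (N : nat) (A : 'M[algC]_N) : seq algC :=
  sval (closed_field_poly_normal (char_poly A)).

Definition CN_energy (g : sgraph) : algC :=
  \sum_(z <- eigenvalues (CN_matrix g)) `|z|.

Definition CN_hyperenergetic (g : sgraph) : Prop :=
  CN_energy g > CN_energy (complete_graph #|g|).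

End CNEnergy.

Section CommutingConjugacyClassGraph.
Local Open Scope group_scope.
Variables (gT : finGroupType) (G : {group gT}).

Definition noncentral_classes : {set {set gT}} :=
  [set a ^: G | a in G :\: 'Z(G)].

Definition ccc_vertex : finType := {A : {set gT} | A \in noncentral_classes}.

Definition ccc_edge : rel ccc_vertex := fun A B =>
  (A != B) && [exists a in val A, exists b in val B, a * b == b * a].

Lemma ccc_edge_sym : symmetric ccc_edge.
Proof.
move=> A B; rewrite /ccc_edge eq_sym; congr (_ && _).
by apply/exists_inP/exists_inP => -[a aA /exists_inP[b bB /eqP ab]];
  exists b => //; apply/exists_inP; exists a => //; rewrite ab.
Qed.

Lemma ccc_edge_irr : irreflexive ccc_edge.
Proof. by move=> A; rewrite /ccc_edge eqxx. Qed.

Definition ccc_graph : sgraph := SGraph ccc_edge_sym ccc_edge_irr.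

End CommutingConjugacyClassGraph.

Section V8n.
Local Open Scope group_scope.

(* [\isog Grp] characterises [G] as the largest finite quotient of the
   presented group.  The relations give [y x y = x^-1 = y^-1 x y^-1], so [y^2]
   is central and <x, y^2> is an abelian normal subgroup of index at most 2:
   the presented group is finite, hence [G] is isomorphic to it. *)
Definition is_V8n (n : nat) (gT : finGroupType) (G : {group gT}) : Prop :=
  G \isog Grp (x : y : x ^+ (2 * n) = 1, y ^+ 4 = 1,
                       y * x = x^-1 * y^-1, y^-1 * x = x^-1 * y).

End V8n.

(* Main.v *)
Require Import Defs.
From HB Require Import structures.
From mathcomp Require Import all_boot all_order all_fingroup all_algebra all_solvable all_field.

Set Implicit Arguments.
Unset Strict Implicit.
Unset Printing Implicit Defensive.

Import Order.TTheory GRing.Theory Num.Theory.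

(** The argument has a group-theoretic half and a spectral half, which meet in
    the notion of a cluster graph: a disjoint union of complete graphs.

    Group theory.  The relations make [y ^+ 2] commute with [x] and give
    [x ^ y = x^-1 * y ^+ 2], so that [<x, y ^+ 2>] is an abelian subgroup of
    index at most 2 ([V8n_abelian_index2]).  In a group with such a subgroup the
    centraliser of every noncentral element is abelian
    ([abelian_cent1_index2]), hence commutation is transitive on noncentral
    elements, and after conjugation adjacency of distinct conjugacy classes is
    transitive too ([ccc_cluster]).

    Spectrum.  A component with [m] vertices contributes to the
    common-neighbourhood matrix the block [(m - 2)(J - I)], with [J] the
    all-ones matrix.  Its eigenvalues are [(m - 1)(m - 2)], once, and
    [- (m - 2)], [m - 1] times, so that its energy is [2 (m - 1)(m - 2)].
    Attaching one term [2 (m - 2)] to each vertex other than a chosen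
    representative of its component, the energy of a cluster graph is a sum of
    such terms ([cluster_energy]).  On [N > 0] vertices there are at most
    [N - 1] of them, each at most [2 (N - 2)], whereas the complete graph, which
    is a single cluster, has exactly [N - 1] terms equal to [2 (N - 2)]. *)

(** * Eigenvalues of an explicitly diagonalised matrix *)

Section Spectrum.
Local Open Scope ring_scope.

Lemma char_poly_similar (F : fieldType) (N : nat) (P A B : 'M[F]_N) :
  P \in unitmx -> P *m A = B *m P -> char_poly A = char_poly B.
Proof.
move=> Punit PA; pose P' := map_mx polyC P.
have detP' : \det P' != 0.
  by rewrite det_map_mx polyC_eq0 -unitfE -unitmxE.
apply: (mulfI detP'); rewrite /char_poly -det_mulmx [RHS]mulrC -det_mulmx.
congr (\det _); rewrite /char_poly_mx mulmxBr mulmxBl -!map_mxM PA.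
by rewrite mul_mx_scalar mul_scalar_mx.
Qed.

Lemma eigenvalues_diagonalized (N : nat) (A P : 'M[algC]_N) (d : 'rV[algC]_N) :
  P \in unitmx -> P *m A = diag_mx d *m P ->
  perm_eq (eigenvalues A) [seq d 0 i | i <- enum 'I_N].
Proof.
move=> Punit PA; rewrite /eigenvalues; case: closed_field_poly_normal => s /=.
rewrite (monicP (char_poly_monic A)) scale1r => As.
apply: prod_XsubC_eq; rewrite -As (char_poly_similar Punit PA).
rewrite char_poly_trig ?diag_mx_is_trig // big_map big_enum /=.
by apply: eq_bigr => i _; rewrite mxE eqxx mulr1n.
Qed.

(** * The energy of a block matrix with blocks [(m - 2)(J - I)] *)

Section Blocks.
(** The blocks are the fibres of an idempotent map [r], which sends each index
    to the representative of its block. *)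
Variables (N : nat) (r : 'I_N -> 'I_N).
Hypothesis rK : forall i, r (r i) = r i.

Let m i := #|[set j | r j == r i]|.

Let A : 'M[algC]_N :=
  \matrix_(i, j) (if i == j then 0 else if r i == r j then ((m i).-2)%:R else 0).

(** A block with representative [i] has the eigenvalue [(m - 1)(m - 2)], listed
    at [i], and the eigenvalue [- (m - 2)], listed at its other indices. *)
Let d : 'rV[algC]_N :=
  \row_i (if r i == i then ((m i).-1 * (m i).-2)%:R else - ((m i).-2)%:R).

(** The rows are the matching eigenvectors: the indicator of the block at its
    representative, and [e_i - e_(r i)] at every other index. *)
Let P : 'M[algC]_N :=
  \matrix_(i, j) (if r i == i then (r j == i)%:R
                  else (j == i)%:R - (j == r i)%:R).

Let AE i j : A i j = (m j).-2%:R * ((r i == r j)%:R - (i == j)%:R).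
Proof.
rewrite mxE; case: eqVneq => [->|_]; first by rewrite eqxx subrr mulr0.
rewrite subr0; case: (r i =P r j) => [rij|_]; last by rewrite mulr0.
by rewrite mulr1 /m rij.
Qed.

Lemma block_eigenbasis : P *m A = diag_mx d *m P.
Proof.
apply/matrixP => i k; rewrite mul_diag_mx !mxE.
case: (r i =P i) => [ri|/eqP nri].
  under eq_bigr => j _ do rewrite AE mulrCA mxE ri eqxx.
  rewrite -mulr_sumr.
  case: (r k =P i) => [rk|nrk]; last first.
    rewrite mulr0 big1 ?mulr0 // => j _.
    case: (r j =P i) => [rj|_]; last by rewrite mul0r.
    rewrite mul1r rj; case: eqP => [/esym //|_].
    by case: eqP => [jk|_]; [rewrite -jk in nrk | rewrite subr0].
  have -> : m i = m k by rewrite /m rk ri.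
  rewrite mulr1 natrM mulrC; congr (_ * _).
  under eq_bigr => j _ do rewrite mulrBr.
  rewrite sumrB (bigD1 k) //= (bigD1 k (F := fun j => _ * (j == k)%:R)) //=.
  rewrite [X in _ - (_ + X)]big1 => [|j /negbTE ->]; last by rewrite mulr0.
  rewrite rk !eqxx addr0 mulr1 addrAC subrr add0r.
  rewrite /m (cardsD1 k) inE eqxx add1n /= -sum1_card natr_sum big_mkcond /=.
  rewrite [RHS]big_mkcond /=; apply: eq_bigr => j _; rewrite !inE rk.
  by case: (j != k); case: (r j == i); rewrite ?mulr1 ?mulr0.
under eq_bigr => j _ do rewrite AE mxE (negbTE nri) mulrBl.
rewrite sumrB (bigD1 i) //= big1 => [|j /negbTE ->]; last by rewrite mul0r.
rewrite (bigD1 (r i)) //= big1 => [|j /negbTE ->]; last by rewrite mul0r.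
rewrite !eqxx !mul1r !addr0 rK -mulrBr opprB addrC addrA subrK.
rewrite mulNr -mulrN opprB.
have mE : r i = r k -> m k = m i by rewrite /m => ->.
rewrite [k == i]eq_sym [k == r i]eq_sym.
case: (i =P k) => [ik|_]; first by rewrite mE ?ik.
case: (r i =P k) => [ik|_]; first by rewrite mE // -ik rK.
by rewrite subrr !mulr0.
Qed.

(** In a vanishing combination of the rows of [P], the coefficient at each
    nonrepresentative index is opposite to the one at its representative [k];
    column [k] then says that [m k] times the latter is zero. *)
Lemma block_eigenbasis_unit : P \in unitmx.
Proof.
rewrite -row_free_unit; apply: inj_row_free => v vP.
have col k : \sum_i v 0 i * P i k = 0.
  by have /matrixP/(_ 0 k) := vP; rewrite !mxE.
have vN k : r k != k -> v 0 k = - v 0 (r k).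
  move=> nk; apply/eqP; rewrite -addr_eq0 -(col k).
  rewrite (bigD1 k) //= (bigD1 (r k)) //= big1 => [|i /andP[ik irk]].
    by rewrite !mxE rK eqxx (negbTE nk) !eqxx [k == r k]eq_sym (negbTE nk)
       subr0 !mulr1 addr0.
  rewrite mxE [r k == i]eq_sym (negbTE irk) [k == i]eq_sym (negbTE ik).
  case: eqP => _; first by rewrite mulr0.
  case: eqP => [kE|_]; last by rewrite subrr mulr0.
  by move: nk; rewrite kE rK eqxx.
have v0 k : r k = k -> v 0 k = 0.
  move=> rk; have := col k.
  rewrite (bigID (fun i => r i == k)) /= [X in _ + X]big1 => [|i rik]; last first.
    rewrite mxE [k == r i]eq_sym (negbTE rik) rk [k == i]eq_sym subr0.
    case: (i =P k) => [ik|]; first by rewrite ik rk eqxx in rik.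
    by move=> _; case: ifP; rewrite mulr0.
  rewrite addr0 (eq_bigr (fun=> v 0 k)) => [|i /eqP rik]; last first.
    rewrite mxE rk rik [k == i]eq_sym; case: (i =P k) => [->|/eqP ik].
      by rewrite mulr1.
    have ri : r i != i by rewrite rik eq_sym.
    by rewrite (vN _ ri) rik eqxx sub0r mulrNN mulr1.
  rewrite sumr_const => /eqP; rewrite mulrn_eq0 => /orP[|/eqP //].
  by move/eqP/card0_eq/(_ k); rewrite unfold_in /= rk (introT eqnP erefl).
apply/rowP => k; rewrite mxE; case: (r k =P k) => [/v0 //|/eqP/vN ->].
by rewrite v0 ?rK ?oppr0.
Qed.

(** The trace is zero, so the positive eigenvalues have the same sum as the
    absolute values of the negative ones: in each block, [(m - 1)(m - 2)] at the
    representative balances [m - 1] terms [m - 2]. *)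
Lemma energy_block :
  \sum_(z <- eigenvalues A) `|z| = (\sum_(i | r i != i) (m i).-2).*2%:R.
Proof.
rewrite (perm_big _ (eigenvalues_diagonalized block_eigenbasis_unit block_eigenbasis)) /=.
rewrite big_map big_enum /= (bigID (fun i => r i == i)) /= -addnn natrD.
congr (_ + _); last first.
  by rewrite natr_sum; apply: eq_bigr => i ri; rewrite mxE (negbTE ri) normrN normr_nat.
rewrite (eq_bigr (fun i => ((m i).-1 * (m i).-2)%:R)) => [|i ri]; last first.
  by rewrite mxE ri normr_nat.
rewrite -natr_sum [in RHS](partition_big r (fun i => r i == i)) /=; last first.
  by move=> i _; rewrite rK.
congr (_%:R); apply: eq_bigr => i /eqP ri.
rewrite [RHS](eq_bigr (fun=> (m i).-2)) => [|j /andP[_ /eqP rj]]; last first.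
  by rewrite /m rj ri.
rewrite sum_nat_const; congr (_ * _)%N.
rewrite /m (cardsD1 i) inE eqxx /=; apply: eq_card => j; rewrite !inE ri.
rewrite unfold_in; case: (r j =P i) => [->|]; rewrite ?andbF ?andbT //.
by rewrite eq_sym.
Qed.

End Blocks.
End Spectrum.

(** * Cluster graphs *)

Definition cluster (g : sgraph) :=
  forall u v w : g, sedge u v -> sedge v w -> (u == w) || sedge u w.

Section Cluster.
Variable g : sgraph.
Hypothesis gP : cluster g.
Let r : g -> g := fingraph.root (sedge (s := g)).

Lemma cluster_connect_sym : connect_sym (sedge (s := g)).
Proof. exact: sym_connect_sym (@sedge_sym g). Qed.

Lemma cluster_connect (u v : g) : connect sedge u v = (u == v) || sedge u v.
Proof.
apply/idP/idP => [/connectP[p pP ->]|/orP[/eqP->|/connect1 //]]; last exact: connect0.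
elim/last_ind: p pP => [|p w IHp]; first by rewrite eqxx.
rewrite rcons_path last_rcons => /andP[/IHp/orP[/eqP<- ->|up /(gP up) //]].
exact: orbT.
Qed.

Lemma cluster_root (u v : g) : (r u == r v) = (u == v) || sedge u v.
Proof. by rewrite root_connect ?cluster_connect //; exact: cluster_connect_sym. Qed.

(** Since [u != v], both vertices lie in their common component and have to be
    discarded from it. *)
Lemma cluster_common_neighbours (u v : g) : u != v ->
  #|common_neighbours u v| = if r u == r v then #|[set w | r w == r u]|.-2 else 0.
Proof.
move=> uv; have edgeE (a w : g) : (w != a) && sedge a w = (w != a) && (r w == r a).
  by rewrite eq_sym [r w == _]eq_sym cluster_root; case: eqP.
have -> : common_neighbours u v = [set w | r w == r u & r w == r v] :\ u :\ v.
  apply/setP => w; rewrite !inE; move: (edgeE u w) (edgeE v w).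
  by case: (w == u); case: (w == v) => //= -> ->.
case: ifP => ruv; last first.
  apply/eqP; rewrite cards_eq0; apply/eqP/setP => w; rewrite !inE.
  by case: (r w =P r u) => [->|]; rewrite ?ruv ?andbF.
have -> : [set w | r w == r u & r w == r v] = [set w | r w == r u].
  by apply/setP => w; rewrite !inE -(eqP ruv) andbb.
rewrite [in RHS](cardsD1 u) [in RHS](cardsD1 v) !inE eqxx eq_sym uv.
by rewrite /= -(eqP ruv) eqxx.
Qed.

(** The representatives of the components, read through the enumeration of the
    vertices, exhibit the common-neighbourhood matrix as a block matrix. *)
Lemma cluster_energy :
  CN_energy g = (\sum_(u | r u != u) #|[set w | r w == r u]|.-2).*2%:R%R.
Proof.
pose s (i : 'I_#|g|) := enum_rank (r (enum_val i)).
have sE i j : (s i == s j) = (r (enum_val i) == r (enum_val j)).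
  exact: (inj_eq enum_rank_inj).
have sK i : s (s i) = s i.
  by rewrite /s enum_rankK /r root_root //; exact: cluster_connect_sym.
have card_s i : #|[set j | s j == s i]| = #|[set w | r w == r (enum_val i)]|.
  rewrite -(card_imset _ enum_val_inj); apply: eq_card => w.
  rewrite inE; apply/imsetP/idP => [[j + ->]|wi]; first by rewrite inE sE.
  by exists (enum_rank w); rewrite ?inE ?sE ?enum_rankK.
have -> : \sum_(u | r u != u) #|[set w | r w == r u]|.-2
        = \sum_(i | s i != i) #|[set j | s j == s i]|.-2.
  rewrite (reindex_onto enum_val enum_rank) /=; last first.
    by move=> u _; rewrite enum_rankK.
  apply: eq_big => [i|i _]; last by rewrite card_s.
  by rewrite enum_valK eqxx andbT -(inj_eq enum_rank_inj) enum_valK.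
rewrite -(energy_block sK); congr (\sum_(z <- eigenvalues _) `|z|)%R.
apply/matrixP => i j; rewrite !mxE; case: eqVneq => // ij.
rewrite cluster_common_neighbours ?(inj_eq enum_val_inj) // sE card_s.
by case: ifP.
Qed.

(** A nonempty graph has at least one representative, hence at most [N - 1]
    terms in its energy, and no component has more than [N] vertices. *)
Lemma cluster_energy_le : (CN_energy g <= (#|g|.-1 * #|g|.-2).*2%:R)%R.
Proof.
rewrite cluster_energy ler_nat leq_double.
apply: leq_trans (_ : \sum_(u | r u != u) #|g|.-2 <= _).
  apply: leq_sum => u _; rewrite -!subn2 leq_sub2r //.
  exact: max_card.
rewrite sum_nat_const leq_mul2r; apply/orP; right.
case: (posnP #|g|) => [g0|/card_gt0P[u _]]; first by rewrite (leq_trans (max_card _)) ?g0.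
rewrite -[leqRHS](cardC1 (r u)); apply/subset_leq_card/subsetP => w.
rewrite !inE; apply: contraNneq => ->.
by rewrite /r root_root //; exact: cluster_connect_sym.
Qed.

End Cluster.

Lemma complete_cluster N : cluster (complete_graph N).
Proof. by move=> u v w _ _; exact: orbN. Qed.

Lemma complete_energy N : CN_energy (complete_graph N) = (N.-1 * N.-2).*2%:R%R.
Proof.
rewrite cluster_energy; last exact: complete_cluster.
set r := fingraph.root _; have rE (u v : complete_graph N) : r u = r v.
  by apply/eqP; rewrite cluster_root; [exact: orbN | exact: complete_cluster].
congr (_.*2%:R)%R; rewrite (eq_bigr (fun=> N.-2)) => [|u _]; last first.
  congr _.-2; rewrite -[RHS]card_ord; apply: eq_card => w.
  by rewrite inE (rE w u) eqxx.
rewrite sum_nat_const; case: N r rE => [|N] r rE; first by rewrite muln0.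
congr muln; rewrite -[in RHS](card_ord N.+1) -(cardC1 (r ord0)); apply: eq_card => w.
by rewrite !inE unfold_in /= (rE w ord0) eq_sym.
Qed.

Lemma cluster_not_CN_hyperenergetic g : cluster g -> ~ CN_hyperenergetic g.
Proof.
move=> gP; rewrite /CN_hyperenergetic complete_energy => /lt_geF.
by rewrite cluster_energy_le.
Qed.

(** * Commuting classes *)

Section CommutingTransitive.
Local Open Scope group_scope.
Variables (gT : finGroupType) (G : {group gT}).

(** If [a] commutes with [b], and a conjugate [b'] of [b] commutes with [c],
    then conjugating [b'] to [b] sends [c] to an element that centralises [b]
    like [a], hence commutes with [a]. *)
Lemma ccc_cluster :
  (forall b, b \in G :\: 'Z(G) -> abelian 'C_G[b]) -> cluster (ccc_graph G).
Proof.
move=> cG [U Uv] [V Vv] [W Wv] /andP[_ UV] /andP[_ VW].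
have [->//|neUW] := eqVneq; rewrite /= /ccc_edge neUW /=.
move: UV VW => /exists_inP[/= a aU /exists_inP[b bV /eqP ab]].
move=> /exists_inP[/= b' b'V /exists_inP[c cW /eqP bc]].
have [u /setDP[Gu _] UE] := imsetP Uv.
have [v /setDP[Gv ncv] VE] := imsetP Vv.
have [w /setDP[Gw _] WE] := imsetP Wv.
have inG (t z : gT) : t \in G -> z \in t ^: G -> z \in G.
  by move=> Gt /imsetP[s Gs ->]; rewrite groupJ.
have Gb : b \in G by apply: (inG v); rewrite // -VE.
have /imsetP[x Gx bx] : b \in b' ^: G.
  by move: bV b'V; rewrite VE => bV /class_eqP ->.
apply/exists_inP; exists a => //; apply/exists_inP; exists (c ^ x).
  by move: cW; rewrite WE memJ_norm // (subsetP (class_norm _ _)).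
suff /centsP cC : abelian 'C_G[b].
  apply/eqP/cC; apply/setIP; split.
  - by apply: (inG u); rewrite -?UE.
  - exact/cent1P.
  - by rewrite groupJ // (inG w) -?WE.
  - by rewrite bx cent1J memJ_conjg; apply/cent1P.
apply: cG; apply/setDP; split=> //.
apply: contra ncv => Zb; move: bV; rewrite VE class_sym => /imsetP[y Gy ->].
by rewrite conjgE -(centerC Gy Zb) mulKg.
Qed.

(** If the index is 1 then [G] itself is abelian; let it be 2.
    For [b] in [A], the centraliser of [b] is a proper subgroup that contains
    the maximal subgroup [A], so it is [A].  For [b] outside [A], each element
    of the centraliser lies in [A] or in [A b], so the centraliser is generated
    by [b] and by its intersection with [A], which commutes with [b]. *)
Lemma abelian_cent1_index2 (A : {group gT}) b :
    A \subset G -> abelian A -> #|G : A| <= 2 ->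
  b \in G :\: 'Z(G) -> abelian 'C_G[b].
Proof.
move=> sAG cAA; rewrite leq_eqVlt => /predU1P[iA|]; last first.
  rewrite ltnS leqNgt indexg_gt1 negbK => sGA _.
  by rewrite (abelianS _ cAA) // (subset_trans (subsetIl _ _)).
case/setDP=> Gb ncb; have [Ab|nAb] := boolP (b \in A).
  have /maxgroupP[_ maxA] : maximal A G by rewrite p_index_maximal ?iA.
  rewrite (maxA 'C_G[b]%G) //=.
    rewrite properE subsetIl subsetI subxx /=.
    by apply: contra ncb => sGC; rewrite !inE Gb -sub_cent1.
  by rewrite subsetI sAG sub_cent1 (subsetP cAA).
have sC : 'C_G[b] \subset 'C_A[b] <*> <[b]>.
  apply/subsetP => c /setIP[Gc cbc].
  have [Ac|nAc] := boolP (c \in A).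
    by apply: (subsetP (joing_subl _ _)); apply/setIP.
  rewrite -(mulgKV b c) groupM //; last first.
    by rewrite (subsetP (joing_subr _ _)) ?cycle_id.
  apply: (subsetP (joing_subl _ _)); apply/setIP; split; last first.
    by rewrite groupM ?groupV ?cent1id.
  rewrite -mem_rcoset (rcoset_index2 sAG iA); first exact/setDP.
  exact/setDP.
apply: abelianS sC _; rewrite abelianY (abelianS _ cAA) ?subsetIl //.
rewrite cycle_abelian /= cycle_subG.
by rewrite (subsetP (centS (subsetIr A 'C[b]))) // -sub_cent1.
Qed.

(** The second relation says [x ^ y = x^-1 * y ^+ 2].  With [y ^+ 4 = 1] the
    first one says the same of [x ^ y^-1], so [x] is fixed by [y ^+ 2].  Hence
    [y] normalises the abelian group [A] generated by [x] and [y ^+ 2], and the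
    quotient by [A] is generated by an image of [y] whose square is trivial. *)
Lemma V8n_abelian_index2 n : is_V8n n G ->
  exists A : {group gT}, [/\ A \subset G, abelian A & #|G : A| <= 2].
Proof.
move/isoGrp_hom/existsP=> [[x y]] /=; case/eqP=> defG _ y4 r1 r2.
have xy : x ^ y = x^-1 * y ^+ 2 by rewrite conjgE mulgA r2 -mulgA.
have yV2 : y ^- 2 = y ^+ 2.
  by apply/eqP; rewrite eq_invg_mul -expgD; apply/eqP.
have xyV : x ^ y^-1 = x^-1 * y ^+ 2.
  by rewrite conjgE invgK mulgA r1 -mulgA -invMg yV2.
have xy2 : commute (y ^+ 2) x.
  have : x = y ^- 2 * x * y ^+ 2.
    rewrite -[LHS](conjgKV y) xyV conjMg conjVg xy invMg invgK.
    by rewrite conjXg conjgE mulKg.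
  by rewrite /commute -mulgA => {1}->; rewrite mulKVg.
have Gx : x \in G by rewrite -defG mem_gen // inE cycle_id.
have Gy : y \in G by rewrite -defG mem_gen // inE cycle_id orbT.
pose A := (<[x]> <*> <[y ^+ 2]>)%G; exists A.
have sAG : A \subset G by rewrite join_subG !cycle_subG Gx groupX.
have Ax : x \in A by rewrite mem_gen // inE cycle_id.
have Ay2 : y ^+ 2 \in A by rewrite mem_gen // inE cycle_id orbT.
split=> //; first by rewrite abelianY !cycle_abelian cents_cycle.
have nAy : y \in 'N(A).
  rewrite inE conjYg join_subG -!cycleJ !cycle_subG xy conjXg (conjgE y) mulKg.
  by rewrite groupM ?groupV.
have nAG : G \subset 'N(A).
  by rewrite -defG join_subG !cycle_subG nAy (subsetP (normG A)).
have -> : #|G : A| = #[coset A y].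
  rewrite -card_quotient //= -defG quotientY ?cycle_subG //; last first.
    exact: (subsetP (normG A)).
  rewrite (quotientS1 (_ : <[x]> \subset A)) ?joing_subl // joing1G.
  by rewrite /= quotient_cycle.
by rewrite dvdn_leq // order_dvdn -morphX //= coset_id.
Qed.

End CommutingTransitive.

Theorem theorem3p4 (n : nat) (gT : finGroupType) (G : {group gT})
  (hn : 2 <= n) (hG : is_V8n n G) :
  ~ CN_hyperenergetic (ccc_graph G).
Proof.
have [A [sAG cAA iGA]] := V8n_abelian_index2 hG.
apply/cluster_not_CN_hyperenergetic/ccc_cluster => b.
exact: abelian_cent1_index2 sAG cAA iGA.
Qed.
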